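(* Suppose that a finite soluble group $G$ has the following property: if $A$ is a non-trivial irreducible $G$-module $G$-isomorphic to a complemented chief factor of $G$, then $|\operatorname{End}_G(A)|>2$ (this holds in particular when the derived subgroup of $G$ is either nilpotent or of odd order). If $d\geq d(G)$, then the diameter of the swap graph $\Sigma_d(G)$ is at most $2d-1$.
   Context: For a finite group $G$, $d(G)$ is the smallest cardinality of a generating set of $G$. For a $d$-generator finite group $G$, the swap graph $\Sigma_d(G)$ is the graph whose vertices are the ordered generating $d$-tuples of $G$, two vertices $(x_1,\dots,x_d)$ and $(y_1,\dots,y_d)$ being adjacent if and only if they differ only by one entry. A chief factor $X/Y$ of $G$ is complemented if $X/Y$ has a complement in $G/Y$; chief factors of the soluble group $G$ are abelian and are regarded as $G$-modules via conjugation. A non-trivial irreducible $G$-module is one on which $G$ acts non-trivially, and $\operatorname{End}_G(A)$ denotes the ring of $G$-endomorphisms of $A$. *)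

(* Defs.v *)
From HB Require Import structures.
From mathcomp Require Import all_boot all_fingroup all_solvable.

Set Implicit Arguments.
Unset Strict Implicit.
Unset Printing Implicit Defensive.

Import GroupScope.

Section GraphDistance.

Variables (T : finType) (e : rel T).

(* Shortest length of an e-walk from x to y. A shortest walk has fewer than
   #|T| edges, so the value #|T| means that y is not reachable from x. *)
Definition gdist (x y : T) : nat :=
  find (fun n => [exists p : n.-tuple T, path e x p && (last x p == y)])
       (iota 0 #|T|).

Definition graph_connected : Prop := forall x y : T, connect e x y.

(* Meaningful when e is connected. *)
Definition diameter : nat := \max_(x : T) \max_(y : T) gdist x y.

End GraphDistance.

Section SwapGraph.

Variables (gT : finGroupType) (G : {group gT}) (d : nat).

Definition swap_vertex : predArgType :=
  {x : d.-tuple gT | <<[set y in x]>> == G}.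

Definition swap_adj (u v : swap_vertex) : bool :=
  #|[set i : 'I_d | tnth (val u) i != tnth (val v) i]| == 1%N.

End SwapGraph.

(* A G-module is an abelian group M (written multiplicatively) with an action
   to : groupAction G M of G on M by automorphisms. *)
Section Modules.

Variables (gT : finGroupType) (G : {group gT}).

Section OneModule.

Variables (rT : finGroupType) (M : {group rT}) (to : groupAction G M).

(* An endomorphism of M is encoded as a function on rT that is constantly 1
   outside M, so that each endomorphism is counted exactly once. *)
Definition module_End : {set {ffun rT -> rT}} :=
  [set f : {ffun rT -> rT} |
     [&& f \in pffun_on 1 M M, morphic M f &
         [forall g in G, forall m in M, f (to m g) == to (f m) g]]].

Definition nontrivial_irreducible_module : Prop :=
  [/\ abelian M, acts_irreducibly G M to & ~~ (G \subset 'C(M | to))].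

(* X / Y carries the conjugation action of G, for Y normal in G. *)
Definition isom_to_factor (X Y : {group gT}) : Prop :=
  exists f : {morphism M >-> coset_of Y},
    isom M (X / Y) f /\
    {in G & M, forall g m, f (to m g) = f m ^ coset Y g}.

End OneModule.

Definition complemented_chief_factor (X Y : {group gT}) : Prop :=
  chief_factor G Y X /\ [splits G / Y, over X / Y].

Definition large_End_property : Prop :=
  forall (rT : finGroupType) (M : {group rT}) (to : groupAction G M),
    nontrivial_irreducible_module to ->
    (exists X Y : {group gT},
       complemented_chief_factor X Y /\ isom_to_factor to X Y) ->
    2 < #|module_End to|.

End Modules.

(* Main.v *)
Require Import Defs.
From HB Require Import structures.
From mathcomp Require Import all_boot all_fingroup all_solvable.

Set Implicit Arguments.
Unset Strict Implicit.
Unset Printing Implicit Defensive.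

Import GroupScope.

(** The diameter bound reduces to a statement about one entry at a time: if
    [<H1, x> = G = <H2, y>] then some [z] satisfies [<H1, z> = G = <H2, z>]
    ([large_End_common_generator]).  Indeed, given two generating tuples [u]
    and [v], take for [H1] and [H2] the subgroups generated by the entries of
    [u] and of [v] other than the first one; replacing the first entries of
    both by the same [z] costs one swap at each end, and the two new tuples
    agree in one more place.  After [d - 1] such rounds the tuples differ only
    in the last entry, and one more swap joins them: [2 (d - 1) + 1] swaps in
    all ([swap_walk]).

    The element [z] is found by descending along chief factors, from [G / G']
    down to [G].  In the abelian group [G / G'], [z] can be taken of the form
    [x ^ a y ^ b], the exponents being chosen prime by prime
    ([abelian_common_generator]).  For the inductive step let [N] be a minimal
    normal subgroup of a quotient of [G], contained in the derived subgroup,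
    and suppose that [z] works modulo [N]; it has to be corrected by an [n] in
    [N].  If [<H, z n>] is not the whole group then it is a complement of [N],
    and [n] is determined by this complement, which contains [H].  Such
    complements correspond to the derivations into [N] that vanish on [H].
    Their values at a suitable element form a subgroup [U] of [N] which is
    stable under module endomorphisms; it is proper, because [<H, x>] is the
    whole group.  If [|End(N)| > 2], it follows that [U] has index at least 3
    in [N] ([index_endo_stable_gt2]).  So fewer than half of the elements of
    [N] are bad for [H1], fewer than half are bad for [H2], and some [n] is
    good for both ([card_nongenerating_translates],
    [common_generator_minnormal]).  The
    hypothesis on endomorphisms applies to [N], since a complemented minimal
    normal subgroup that lies in the derived subgroup cannot be central
    ([complemented_der1_not_central]).

    For the two sufficient conditions, an irreducible module with nontrivial
    action has more than two endomorphisms as soon as one of them is neither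
    trivial nor the identity.  If [G'] is nilpotent then it centralizes every
    chief factor, so that any element of [G] acting nontrivially provides such
    an endomorphism.  If [|G'|] is odd then a chief factor of even order is a
    2-group that meets the image of [G'] trivially, hence is central; on a
    module of odd order squaring is such an endomorphism. *)

(** * Common generators over two subgroups *)

Definition common_generator (gT : finGroupType) (G N : {group gT}) : Prop :=
  forall (H1 H2 : {group gT}) (x y : gT),
    H1 <*> <[x]> <*> N = G -> H2 <*> <[y]> <*> N = G ->
    exists z, H1 <*> <[z]> <*> N = G /\ H2 <*> <[z]> <*> N = G.

Lemma mem_join_cycle (gT : finGroupType) (H : {group gT}) x : x \in H <*> <[x]>.
Proof. by rewrite mem_gen // inE cycle_id orbT. Qed.

Lemma join_cycle_sub (gT : finGroupType) (G H : {group gT}) x :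
  H <*> <[x]> = G -> H \subset G /\ x \in G.
Proof. by move=> <-; rewrite joing_subl mem_join_cycle. Qed.

Lemma join_cycle_sub_mod (gT : finGroupType) (G H N : {group gT}) x :
  H <*> <[x]> <*> N = G -> H \subset G /\ x \in G.
Proof.
move=> <-; split; first by rewrite -joingA joing_subl.
by rewrite mem_gen // inE mem_join_cycle.
Qed.

(** The property depends only on [G / X]; it is used with [X = Y] to pass to
    [G / Y], and with [X / Y] a chief factor. *)
Lemma common_generator_quotient (gT : finGroupType) (G X Y : {group gT}) :
    Y <| G -> X <| G -> Y \subset X ->
  common_generator G X <-> common_generator (G / Y) (X / Y).
Proof.
move=> nsYG /andP[sXG nXG] sYX; have [sYG nYG] := andP nsYG.
have nYX : X \subset 'N(Y) by apply: subset_trans nYG.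
have quo_gen (H : {group gT}) x : H \subset G -> x \in G ->
    (H / Y) <*> <[coset Y x]> <*> (X / Y) = G / Y <-> H <*> <[x]> <*> X = G.
  move=> sHG Gx; have nYH := subset_trans sHG nYG.
  have nYx : <[x]> \subset 'N(Y) by rewrite cycle_subG (subsetP nYG).
  have -> : (H / Y) <*> <[coset Y x]> <*> (X / Y) = (H <*> <[x]> <*> X) / Y.
    by rewrite !quotientY ?quotient_cycle ?(subsetP nYG) // join_subG nYH.
  split=> [eqHG | -> //].
  have nsYJ : Y <| H <*> <[x]> <*> X.
    apply/andP; split; first exact: subset_trans sYX (joing_subr _ _).
    by apply: subset_trans nYG; rewrite !join_subG sHG cycle_subG Gx.
  by have := congr1 (fun A => coset Y @*^-1 A) eqHG; rewrite /= !quotientGK.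
split=> cgG H1 H2 x y defx defy.
- have [sH1 Gx] := join_cycle_sub_mod defx.
  have [sH2 Gy] := join_cycle_sub_mod defy.
  have lift (H : {group coset_of Y}) : H \subset G / Y ->
      {K : {group gT} | K \subset G & H :=: K / Y}.
    move=> sHG; exists (coset Y @*^-1 H)%G; last by rewrite /= cosetpreK.
    by rewrite -(quotientGK nsYG) morphpreS.
  have [K1 sK1 eK1] := lift _ sH1; have [K2 sK2 eK2] := lift _ sH2.
  have /morphimP[x0 _ Gx0 ex] := Gx; have /morphimP[y0 _ Gy0 ey] := Gy.
  move: defx defy; rewrite eK1 eK2 ex ey => /quo_gen defx /quo_gen defy.
  have [z [dz1 dz2]] := cgG _ _ _ _ (defx sK1 Gx0) (defy sK2 Gy0).
  have [_ Gz] := join_cycle_sub_mod dz1.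
  by exists (coset Y z); split; apply/quo_gen.
have [sH1 Gx] := join_cycle_sub_mod defx.
have [sH2 Gy] := join_cycle_sub_mod defy.
have [z [dz1 dz2]] := cgG (H1 / Y)%G (H2 / Y)%G (coset Y x) (coset Y y)
  ((quo_gen _ _ sH1 Gx).2 defx) ((quo_gen _ _ sH2 Gy).2 defy).
have [_ /morphimP[z0 _ Gz0 ez]] := join_cycle_sub_mod dz1.
by exists z0; split; apply/quo_gen; rewrite // -ez.
Qed.

(** * Abelian groups *)

(** Modulo a prime [p], one of the pairs [(1, 0)], [(0, 1)], [(1, 1)] is a
    solution: the first if [p] does not divide [e], the second if [p] divides
    [e] but not [c], the third if [p] divides both.  The Chinese remainder
    theorem is avoided by taking for [a] and [b] the parts of [m] whose primes
    have to divide them. *)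
Lemma exists_coprime_combinations (m c e : nat) : 0 < m ->
  exists a b, coprime m (a + b * c) /\ coprime m (a * e + b).
Proof.
move=> m_gt0.
pose pa := [pred p : nat | (p %| e) && ~~ (p %| c)].
pose pb := [pred p : nat | ~~ (p %| e)].
exists (m`_pa)%N, (m`_pb)%N.
have dvd (pi : nat_pred) p : prime p -> p %| m -> (p %| (m`_pi)%N) = (p \in pi).
  move=> pr_p pm; apply/idP/idP => [ppi | pip].
    by have := pnatP pi (part_gt0 pi m); rewrite part_pnat => /elimT; apply.
  by rewrite -(part_pnat_id (n := p) (pi := pi)) ?pnatE // partn_dvd.
have cop n : (forall p, prime p -> p %| m -> ~~ (p %| n)) -> coprime m n.
  move=> n'p; rewrite /coprime; apply/negPn/negP => ne1.
  have pr : prime (pdiv (gcdn m n)).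
    by rewrite pdiv_prime // ltn_neqAle eq_sym ne1 gcdn_gt0 m_gt0.
  have := pdiv_dvd (gcdn m n); rewrite dvdn_gcd => /andP[pm pn].
  by move: (n'p _ pr pm); rewrite pn.
split; apply: cop => p pr pm;
  have := dvd pa p pr pm; have := dvd pb p pr pm; rewrite !inE.
- case pe: (p %| e) => /= pb' pa'; last by rewrite dvdn_addl ?pa' ?dvdn_mulr ?pb'.
  case pc: (p %| c) pa' => /= pa'; first by rewrite dvdn_addl ?pa' ?dvdn_mull.
  by rewrite dvdn_addr ?pa' // Euclid_dvdM // pb' pc.
- case pe: (p %| e) => /= pb' pa'; first by rewrite dvdn_addr ?pb' ?dvdn_mull.
  by rewrite dvdn_addl ?pb' // Euclid_dvdM // pa' pe.
Qed.

(** Since [y] is [x ^ c] modulo [H1] and [x] is [y ^ e] modulo [H2], the element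
    [x ^ a y ^ b] is [x ^ (a + b c)] modulo [H1] and [y ^ (a e + b)] modulo
    [H2]; exponents coprime to [|G|] keep the generation property. *)
Lemma abelian_common_generator (gT : finGroupType) (G : {group gT}) :
  abelian G -> common_generator G 1%G.
Proof.
move=> abG H1 H2 x y; rewrite !joingG1 => defx defy.
have [sH1 Gx] := join_cycle_sub defx; have [sH2 Gy] := join_cycle_sub defy.
have cGG (H : {group gT}) u : H \subset G -> u \in G -> <[u]> \subset 'N(H).
  move=> sHG Gu; apply: cents_norm; rewrite cycle_subG.
  by apply: (subsetP (centS sHG)); apply: (subsetP abG).
have /mulsgP[h1 _ H1h1 /cycleP[c ->] eqy] : y \in H1 * <[x]>.
  by rewrite -norm_joinEr ?cGG // defx.
have /mulsgP[h2 _ H2h2 /cycleP[e ->] eqx] : x \in H2 * <[y]>.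
  by rewrite -norm_joinEr ?cGG // defy.
have [a [b [copx copy]]] := exists_coprime_combinations c e (cardG_gt0 G).
pose z := x ^+ a * y ^+ b.
have Gz : z \in G by rewrite groupM ?groupX.
have h1G := subsetP sH1 _ H1h1; have h2G := subsetP sH2 _ H2h2.
have cG u v : u \in G -> v \in G -> commute u v.
  by move=> Gu Gv; apply: (centsP abG).
have gen (H : {group gT}) u h n : H <*> <[u]> = G -> h \in H ->
    z = h * u ^+ n -> coprime #|G| n -> H <*> <[z]> = G.
  move=> defu Hh ez copn; have [sHG Gu] := join_cycle_sub defu.
  apply/eqP; rewrite eqEsubset join_subG sHG cycle_subG Gz /= -{1}defu.
  rewrite join_subG joing_subl /=.
  have : generator <[u]> (u ^+ n).
    by rewrite generator_coprime (coprime_dvdl (order_dvdG Gu)).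
  move=> /eqP->; rewrite cycle_subG; have -> : u ^+ n = h^-1 * z by rewrite ez mulKg.
  by rewrite groupM ?groupV ?mem_join_cycle // mem_gen // inE Hh.
exists z; rewrite !joingG1; split.
  apply: (gen _ x (h1 ^+ b) (a + b * c)%N) => //; first by rewrite groupX.
  rewrite /z {1}eqy expgMn; last by apply: cG; rewrite // groupX.
  by rewrite -expgM expgD mulgA (cG (x ^+ a)) ?groupX // (mulnC b) -mulgA.
apply: (gen _ y (h2 ^+ a) (a * e + b)%N) => //; first by rewrite groupX.
rewrite /z {1}eqx expgMn; last by apply: cG; rewrite // groupX.
by rewrite -expgM expgD mulgA (mulnC a).
Qed.

(** * Endomorphisms of a minimal normal subgroup *)

Definition conj_endo (gT : finGroupType) (G N : {group gT}) (f : gT -> gT) :=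
  [/\ {in N, forall n, f n \in N}, {in N &, {morph f : m n / m * n}}
    & {in G & N, forall g n, f (n ^ g) = f n ^ g}].

(** In additive notation: the ring of [G]-endomorphisms of [N] has an element
    other than 0 and 1. *)
Definition has_nontrivial_endo (gT : finGroupType) (G N : {group gT}) : Prop :=
  exists f, [/\ conj_endo G N f, ~ {in N, forall n, f n = 1}
              & ~ {in N, forall n, f n = n}].

Lemma conj_endo1 (gT : finGroupType) (G N : {group gT}) f :
  conj_endo G N f -> f 1 = 1.
Proof. by case=> _ fM _; apply: (mulgI (f 1)); rewrite -fM ?mulg1. Qed.

Section MinimalNormal.

Variables (gT : finGroupType) (G N : {group gT}).
Hypotheses (minN : minnormal N G) (abN : abelian N) (sNG : N \subset G).

Let nNG : G \subset 'N(N).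
Proof. by have /mingroupp/andP[] := minN. Qed.

Let cN : {in N &, forall u v, commute u v}.
Proof. by move=> u v Nu Nv; apply: (centsP abN). Qed.

(** By Schur's lemma a nonzero endomorphism is injective, so it permutes [U]
    and has no other preimages of elements of [U]. *)
Lemma conj_endo_preim_stable f (U : {group gT}) m :
    conj_endo G N f -> ~ {in N, forall n, f n = 1} ->
    U \subset N -> {in U, forall u, f u \in U} -> m \in N ->
  f m \in U -> m \in U.
Proof.
move=> endf f'1 sUN fU Nm; have f1 := conj_endo1 endf; have [fN fM fJ] := endf.
pose K := [set n in N | f n == 1].
have gK : group_set K.
  apply/group_setP; split=> [|u v]; first by rewrite inE group1 f1 eqxx.
  rewrite !inE => /andP[Nu /eqP fu] /andP[Nv /eqP fv].
  by rewrite groupM // fM // fu fv mulg1 eqxx.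
have K1 : K = 1.
  apply/eqP/negPn/negP=> K'1; case: f'1 => n Nn.
  have /mingroupP[_ /(_ (Group gK)) minK] := minN.
  suff eK : K = N by move: Nn; rewrite -eK inE => /andP[_ /eqP].
  apply: minK; last by apply/subsetP=> u; rewrite inE => /andP[].
  rewrite K'1; apply/subsetP=> g Gg; rewrite inE.
  apply/subsetP=> _ /imsetP[u + ->]; have nN := subsetP nNG _ Gg.
  rewrite !inE memJ_norm // => /andP[Nu /eqP fu].
  by rewrite Nu fJ // fu conj1g eqxx.
have injf : {in N &, injective f}.
  move=> u v Nu Nv eq; have : u * v^-1 \in K.
    by rewrite inE groupM ?groupV // fM ?groupV // eq -fM ?groupV // mulgV f1 eqxx.
  by rewrite K1 => /set1P/eqP; rewrite -eq_mulgV1 => /eqP.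
have fUU : f @: U = U.
  apply/eqP; rewrite eqEcard card_in_imset ?leqnn ?andbT; first last.
    by apply: sub_in2 injf => u /(subsetP sUN).
  by apply/subsetP=> _ /imsetP[u Uu ->]; apply: fU.
rewrite -{1}fUU => /imsetP[u Uu eq].
by rewrite (injf _ _ Nm _ eq) // (subsetP sUN).
Qed.

(** For [m] outside [U], the elements [1], [m] and [f m] lie in three distinct
    cosets of [U], as both [f] and [n |-> f n * n^-1] are nonzero
    endomorphisms. *)
Lemma index_endo_stable_gt2 f (U : {group gT}) :
    conj_endo G N f -> ~ {in N, forall n, f n = 1} ->
    ~ {in N, forall n, f n = n} ->
    U \subset N -> {in U, forall u, f u \in U} -> ~~ (N \subset U) ->
  2 < #|N : U|.
Proof.
move=> endf f'1 f'id sUN fU /subsetPn[m Nm U'm].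
have [fN fM fJ] := endf.
have endg : conj_endo G N (fun n => f n * n^-1).
  split=> [n Nn | u v Nu Nv | g n Gg Nn].
  - by rewrite groupM ?groupV ?fN.
  - rewrite fM // invMg -!mulgA; congr (_ * _).
    by rewrite mulgA cN ?groupM ?groupV ?fN.
  - by rewrite fJ // conjMg conjVg.
have U'fm : f m \notin U.
  by apply: contra U'm; apply: conj_endo_preim_stable endf f'1 _ _ _.
have U'gm : f m * m^-1 \notin U.
  apply: contra U'm; apply: conj_endo_preim_stable endg _ _ _ _ => // [g1|u Uu].
    by case: f'id => n Nn; apply/eqP; rewrite eq_mulgV1 g1.
  by rewrite groupM ?groupV ?fU.
have rU n : n \in N -> U :* n \in rcosets U N.
  by move=> Nn; rewrite -rcosetE imset_f.
have /subset_leq_card : [set U :* 1; U :* m; U :* f m] \subset rcosets U N.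
  by rewrite !subUset !sub1set !rU ?fN.
apply: leq_trans; rewrite -setUA cardsU1 cards2 !inE.
have ne u v : v * u^-1 \notin U -> U :* u != U :* v.
  by apply: contra => /eqP eq; rewrite -mem_rcoset eq rcoset_refl.
by rewrite negb_or !ne ?invg1 ?mulg1.
Qed.

(** * Complements and derivations *)

Lemma proper_supplement_TI (K : {group gT}) :
  K * N = G -> K :!=: G -> K :&: N = 1.
Proof.
move=> defG neKG; apply/eqP/negPn/negP=> ntI.
have /mingroupP[_ minI] := minN.
have sKG : K \subset G by rewrite -defG mulG_subl.
have eI : K :&: N = N.
  apply: (minI (K :&: N)%G); rewrite ?subsetIr //= ntI /= -defG mul_subG //.
    by rewrite normsI ?normG // (subset_trans sKG).
  by apply/cents_norm/(subset_trans abN)/centS/subsetIr.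
case/negP: neKG; apply/eqP; rewrite -defG mulGSid //.
by rewrite -eI subsetIl.
Qed.

Section Derivations.

Variables (H K : {group gT}) (x : gT).
Hypotheses (sHK : H \subset K) (trKN : K :&: N = 1) (defG : K * N = G).
Hypothesis genx : H <*> <[x]> = G.

(** The condition on products says that [k |-> k * d k] is a homomorphism on
    [K]; its image is another complement of [N], still containing [H]. *)
Definition derivations : {set {ffun gT -> gT}} :=
  [set d : {ffun gT -> gT} |
    [&& [forall k in K, d k \in N],
        [forall k in K, forall l in K, d (k * l) == d k ^ l * d l]
      & [forall h in H, d h == 1]]].

Lemma derivationsP (d : {ffun gT -> gT}) :
  reflect [/\ {in K, forall k, d k \in N},
              {in K &, forall k l, d (k * l) = d k ^ l * d l}
            & {in H, forall h, d h = 1}]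
          (d \in derivations).
Proof.
rewrite inE; apply: (iffP and3P) => [[]|[dN dM dH]].
  move=> /forall_inP dN /forall_inP dM /forall_inP dH; split=> //.
    by move=> k l Kk Kl; apply/eqP; have /forall_inP := dM k Kk; apply.
  by move=> h Hh; apply/eqP/dH.
split; [exact/forall_inP | apply/forall_inP=> k Kk | by apply/forall_inP=> h /dH/eqP].
by apply/forall_inP=> l Kl; apply/eqP/dM.
Qed.

Let sKG : K \subset G. Proof. by rewrite -defG mulG_subl. Qed.

Lemma derivation_value_group_set k : k \in K ->
  group_set [set d k | d : {ffun gT -> gT} in derivations].
Proof.
move=> Kk; apply/group_setP; split.
  apply/imsetP; exists [ffun => 1]; rewrite ?ffunE //.
  by apply/derivationsP; split=> [l _ | l m _ _ | h _]; rewrite !ffunE ?conj1g ?mulg1.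
move=> _ _ /imsetP[d /derivationsP[dN dM dH] ->]
  /imsetP[e /derivationsP[eN eM eH] ->].
apply/imsetP; exists [ffun l => d l * e l]; rewrite ?ffunE //.
apply/derivationsP; split=> [l Kl | l m Kl Km | h Hh]; rewrite !ffunE.
- by rewrite groupM ?dN ?eN.
- have nm := subsetP nNG _ (subsetP sKG _ Km).
  have : e l ^ m \in N by rewrite memJ_norm ?eN.
  rewrite dM // eM // conjMg; move: (d l ^ m) (e l ^ m) => a b Nb.
  by rewrite -!mulgA (mulgA (d m)) [d m * b]cN ?dN // -!mulgA.
- by rewrite dH ?eH ?mulg1.
Qed.

Definition derivation_values k (Kk : k \in K) := Group (derivation_value_group_set Kk).

Lemma derivation_values_sub k (Kk : k \in K) : derivation_values Kk \subset N.
Proof. by apply/subsetP=> _ /imsetP[d /derivationsP[dN _ _] ->]; apply: dN. Qed.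

Lemma derivation_values_endo f k (Kk : k \in K) : conj_endo G N f ->
  {in derivation_values Kk, forall u, f u \in derivation_values Kk}.
Proof.
move=> endf; have f1 := conj_endo1 endf; have [fN fM fJ] := endf.
move=> _ /imsetP[d /derivationsP[dN dM dH] ->].
apply/imsetP; exists [ffun l => f (d l)]; rewrite ?ffunE //.
apply/derivationsP; split=> [l Kl | l m Kl Km | h Hh]; rewrite !ffunE.
- by rewrite fN ?dN.
- have Gm := subsetP sKG _ Km; have nm := subsetP nNG _ Gm.
  by rewrite dM // fM ?fJ ?memJ_norm ?dN.
- by rewrite dH.
Qed.

(** If [d k = n] then the complement [{l * d l | l in K}] contains [H] and
    [k * n = x], hence is all of [G]; but it has no more elements than [K]. *)
Lemma derivation_values_proper k n (Kk : k \in K) : n \in N -> x = k * n ->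
  n \notin derivation_values Kk.
Proof.
move=> Nn ex; apply/imsetP=> -[d /derivationsP[dN dM dH] en].
have gL : group_set [set l * d l | l in K].
  apply/group_setP; split; first by apply/imsetP; exists 1; rewrite ?mul1g ?dH.
  move=> _ _ /imsetP[l Kl ->] /imsetP[m Km ->]; apply/imsetP.
  exists (l * m); rewrite ?groupM // dM // !mulgA; congr (_ * _).
  by rewrite -!mulgA; congr (_ * _); rewrite -conjgC.
have sGL : G \subset Group gL.
  rewrite -genx join_subG cycle_subG; apply/andP; split; last first.
    by apply/imsetP; exists k; rewrite -?en.
  apply/subsetP=> h Hh; apply/imsetP; exists h; rewrite ?(subsetP sHK) //.
  by rewrite dH ?mulg1.
have := leq_trans (subset_leq_card sGL) (leq_imset_card _ _).
have /mingroupp/andP[ntN _] := minN.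
rewrite -defG TI_cardMg // -{2}[#|K|]muln1 leq_pmul2l ?cardG_gt0 //.
by rewrite leqNgt cardG_gt1 ntN.
Qed.

(** The value of the derivation at [k] is the element of [N] by which [k] has to
    be multiplied to enter [L]. *)
Lemma complement_derivation (L : {group gT}) : H \subset L -> L :&: N = 1 ->
  L * N = G -> exists2 d : {ffun gT -> gT}, d \in derivations &
    {in K, forall k, k * d k \in L}.
Proof.
move=> sHL trLN defLN.
have dL k : k \in K -> k * (remgr L N k)^-1 \in L.
  by move=> Kk; apply: mem_divgr; rewrite defLN (subsetP sKG).
have dN k : k \in K -> (remgr L N k)^-1 \in N.
  by move=> Kk; rewrite groupV mem_remgr // defLN (subsetP sKG).
exists [ffun k => (remgr L N k)^-1]; last by move=> k Kk; rewrite ffunE dL.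
apply/derivationsP; split=> [k Kk | k l Kk Kl | h Hh]; rewrite !ffunE ?dN //.
  have Gl := subsetP sKG _ Kl; have nl := subsetP nNG _ Gl.
  set a := remgr L N (k * l); set b := remgr L N k; set c := remgr L N l.
  have Na : a^-1 \in N by rewrite dN ?groupM.
  have Nbc : (b^-1) ^ l * c^-1 \in N by rewrite groupM ?memJ_norm ?dN.
  apply/eqP; rewrite eq_sym eq_mulVg1 -in_set1 -[[set 1]]/(1 : {set gT}) -trLN inE.
  rewrite [X in _ && X]groupM ?andbT //; last by rewrite groupV.
  have -> : ((b^-1) ^ l * c^-1)^-1 * a^-1 =
      ((k * b^-1) * (l * c^-1))^-1 * (k * l * a^-1).
    by rewrite conjVg conjgE !invMg !invgK !mulgA mulgKV.
  by apply: groupM; [rewrite groupV; apply: groupM; apply: dL | apply/dL/groupM].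
by rewrite remgr1 ?invg1 // (subsetP sHL).
Qed.

End Derivations.

(** If there is a bad translate at all, it generates with [H] a complement
    [K n0] of [N].  Writing [x = k * m] with [k] in [K n0], each complement
    [K n] from a bad [n] is determined by the derivation value [u] at [k] for
    which [k * u] lies in it.  So there are at most as many bad elements as
    derivation values, and these form a subgroup of index at least 3. *)
Lemma card_nongenerating_translates (H : {group gT}) x z :
    H <*> <[x]> = G -> H <*> <[z]> <*> N = G ->
    ([splits G, over N] -> has_nontrivial_endo G N) ->
  2 * #|[set n in N | H <*> <[z * n]> != G]| < #|N|.
Proof.
move=> genx genz endoN; set B := finset _.
have [sHG Gx] := join_cycle_sub genx.
pose K n := (H <*> <[z * n]>)%G.
have prodN y n : H <*> <[y]> <*> N = G -> n \in N -> (H <*> <[y * n]>) * N = G.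
  move=> geny Nn; have [_ Gy] := join_cycle_sub_mod geny.
  have Gn := subsetP sNG _ Nn.
  rewrite -norm_joinEl; last first.
    by rewrite (subset_trans _ nNG) // join_subG sHG cycle_subG groupM.
  have sJ : N \subset H <*> <[y * n]> <*> N by apply: joing_subr.
  have Jyn : y * n \in H <*> <[y * n]> <*> N by rewrite mem_gen // inE mem_join_cycle.
  apply/eqP; rewrite eqEsubset; apply/andP; split.
    by rewrite !join_subG sHG sNG cycle_subG groupM.
  rewrite -{1}geny !join_subG sJ cycle_subG andbT.
  rewrite (subset_trans (joing_subl _ _) (joing_subl _ _)) /=.
  by rewrite -(groupMr _ (subsetP sJ n Nn)).
have BP n : n \in B -> [/\ n \in N, K n :&: N = 1 & K n * N = G].
  rewrite inE => /andP[Nn neG]; have KN := prodN _ _ genz Nn.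
  by split=> //; apply: proper_supplement_TI.
have [-> | [n0 Bn0]] := set_0Vmem B; first by rewrite cards0 muln0 cardG_gt0.
have [Nn0 trK0 defK0] := BP _ Bn0.
have [f [endf f'1 f'id]] : has_nontrivial_endo G N.
  apply: endoN; apply/splitsP; exists (K n0); apply/complP.
  split; first by rewrite setIC.
  by rewrite -normC // (subset_trans _ nNG) // -defK0 mulG_subl.
have sHK n : H \subset K n by apply: joing_subl.
have /mulsgP[k m Kk Nm ex] : x \in K n0 * N by rewrite defK0.
have Gk : k \in G by rewrite -defK0 -[k]mulg1 mem_mulg.
pose U := derivation_values H defK0 Kk.
have sUN : U \subset N by apply: derivation_values_sub.
have U'm : m \notin U :=
  derivation_values_proper (sHK n0) trK0 defK0 genx Kk Nm ex.
have indU : 2 < #|N : U|.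
  apply: index_endo_stable_gt2 endf f'1 f'id sUN (derivation_values_endo endf) _.
  by apply/subsetPn; exists m.
(* [K n] contains exactly one element of the coset [k N], and that element
   determines [K n], just as [z * n] does. *)
pose phi n := odflt 1 [pick u in U | k * u \in K n].
have phiP n : n \in B -> phi n \in U /\ k * phi n \in K n.
  case/BP=> Nn trK defK; rewrite /phi; case: pickP => [u /andP[] // | none].
  have [d dD dK] := complement_derivation defK0 (sHK n) trK defK.
  by have /andP[] := none (d k); split; [apply: imset_f | apply: dK].
have genK n : n \in B -> K n = (H <*> <[k * phi n]>)%G.
  move=> Bn; have [Nn trK defK] := BP _ Bn; have [Uu Ku] := phiP _ Bn.
  have Nu := subsetP sUN _ Uu; set L := (H <*> _)%G.
  have sLK : L \subset K n by rewrite join_subG sHK cycle_subG.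
  have defL : L * N = G.
    apply: prodN => //; apply/eqP; rewrite eqEsubset !join_subG sHG cycle_subG Gk sNG /=.
    rewrite -{1}genx join_subG cycle_subG ex.
    rewrite (subset_trans (joing_subl _ _) (joing_subl _ _)) /=.
    by rewrite groupM // mem_gen // inE ?mem_join_cycle ?Nm ?orbT.
  apply/val_inj/eqP; rewrite /= eqEsubset andbC -[_ \subset K n]/(L \subset K n) sLK /=.
  have: K n \subset L * (K n :&: N)
    by rewrite setIC group_modl // defL subsetI subxx -defK mulG_subl.
  by rewrite trK mulg1.
have injphi : {in B &, injective phi}.
  move=> n n' Bn Bn' eq; have eK : K n = K n' by rewrite !genK // eq.
  have [[Nn trK _] [Nn' _ _]] := (BP _ Bn, BP _ Bn').
  apply/eqP; rewrite eq_mulVg1 -in_set1 -[[set 1]]/(1 : {set gT}) -trK inE.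
  rewrite [X in _ && X]groupM ?groupV // andbT.
  have -> : n^-1 * n' = (z * n)^-1 * (z * n') by rewrite invMg -mulgA mulKg.
  by rewrite groupM ?groupV ?mem_join_cycle // eK mem_join_cycle.
have leBU : #|B| <= #|U|.
  rewrite -(card_in_imset injphi); apply/subset_leq_card/subsetP=> _ /imsetP[n Bn ->].
  by case: (phiP n Bn).
rewrite -(Lagrange sUN);
apply: leq_ltn_trans (_ : 2 * #|U| < _); first by rewrite leq_mul2l.
by rewrite mulnC ltn_pmul2l ?cardG_gt0.
Qed.

(** Over each of [H1] and [H2] fewer than half of the translates [z * n] fail to
    generate, so one translate generates over both. *)
Lemma common_generator_minnormal :
    ([splits G, over N] -> has_nontrivial_endo G N) ->
  common_generator G N -> common_generator G 1%G.
Proof.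
move=> endoN cgN H1 H2 x y; rewrite !joingG1 => genx geny.
have genN (H : {group gT}) u : H <*> <[u]> = G -> H <*> <[u]> <*> N = G.
  by move=> ->; apply/joing_idPl.
have [z [genz1 genz2]] := cgN _ _ _ _ (genN _ _ genx) (genN _ _ geny).
have := card_nongenerating_translates genx genz1 endoN.
have := card_nongenerating_translates geny genz2 endoN.
set B2 := finset _; set B1 := finset _ => ltB2 ltB1.
have /subsetPn[n Nn] : ~~ (N \subset B1 :|: B2).
  apply/negP=> /subset_leq_card; rewrite leqNgt; case/negP.
  apply: leq_ltn_trans (leq_card_setU _ _) _.
  rewrite -(ltn_pmul2l (ltn0Sn 1)) mulnDr [X in _ < X]mul2n -addnn -addSn.
  exact: leq_add ltB1 (ltnW ltB2).
rewrite !inE Nn /= negb_or !negbK => /andP[/eqP gen1 /eqP gen2].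
by exists (z * n); rewrite !joingG1.
Qed.
End MinimalNormal.

(** * Module endomorphisms and chief factors *)

Lemma module_EndP (gT : finGroupType) (G : {group gT}) (rT : finGroupType)
    (M : {group rT}) (to : groupAction G M) (f : {ffun rT -> rT}) :
  reflect [/\ (forall m, m \notin M -> f m = 1), {in M, forall m, f m \in M},
              {in M &, {morph f : m n / m * n}}
            & {in G & M, forall g m, f (to m g) = to (f m) g}]
          (f \in module_End to).
Proof.
rewrite inE; apply: (iffP and3P).
  case=> /pffun_onP[/subsetP supp fM] /morphicP fMor /forall_inP fJ; split=> //.
  - move=> m M'm; apply/eqP/negPn; apply: contra M'm => fm.
    by apply: supp; rewrite inE.
  - by move=> m Mm; apply: fM; apply/imageP; exists m.
  by move=> g m Gg Mm; apply/eqP; have /forall_inP := fJ g Gg; apply.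
case=> f1 fM fMor fJ; split; last 2 first.
- exact/morphicP.
- by apply/forall_inP=> g Gg; apply/forall_inP=> m Mm; rewrite fJ.
apply/pffun_onP; split; last by move=> _ /imageP[m Mm ->]; apply: fM.
by apply/subsetP=> m; rewrite inE; apply: contraR => /f1->.
Qed.

Lemma card_module_End_gt2P (gT : finGroupType) (G : {group gT})
    (rT : finGroupType) (M : {group rT}) (to : groupAction G M) :
  M :!=: 1 ->
  2 < #|module_End to| <->
  exists f : rT -> rT,
    [/\ {in M, forall m, f m \in M}, {in M &, {morph f : m n / m * n}},
        {in G & M, forall g m, f (to m g) = to (f m) g},
        ~ {in M, forall m, f m = 1} & ~ {in M, forall m, f m = m}].
Proof.
move=> ntM.
have stM g m : g \in G -> m \in M -> to m g \in M by move=> Gg Mm; rewrite gact_stable.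
(* Elements of [module_End to] are [1] outside [M]. *)
pose ext (f : rT -> rT) := [ffun m => if m \in M then f m else 1].
have extE f m : m \in M -> ext f m = f m by move=> Mm; rewrite ffunE Mm.
have extP f : {in M, forall m, f m \in M} -> {in M &, {morph f : m n / m * n}} ->
    {in G & M, forall g m, f (to m g) = to (f m) g} -> ext f \in module_End to.
  move=> fM fMor fJ; apply/module_EndP;
    split=> [m /negbTE M'm | m Mm | m n Mm Mn | g m Gg Mm].
  - by rewrite ffunE M'm.
  - by rewrite extE ?fM.
  - by rewrite !extE ?groupM ?fMor.
  - by rewrite !extE ?stM ?fJ.
pose one := ext (fun=> 1); pose id := ext (fun m => m).
split=> [gt2 | [f [fM fMor fJ f'1 f'id]]].
  have /subsetPn[f Ef] : ~~ (module_End to \subset [set one; id]).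
    apply/negP=> /subset_leq_card; rewrite leqNgt => /negP[].
    by apply: leq_ltn_trans gt2; rewrite cards2 ltnS leq_b1.
  have /module_EndP[f0 fM fMor fJ] := Ef.
  rewrite !inE negb_or => /andP[/eqP f'1 /eqP f'id]; exists f; split=> // [f1 | fid].
    by case: f'1; apply/ffunP=> m; rewrite ffunE; case: ifPn => [/f1 | /f0].
  by case: f'id; apply/ffunP=> m; rewrite ffunE; case: ifPn => [/fid | /f0].
have E1 : one \in module_End to.
  by apply: extP => [m _ | m n _ _ | g m Gg _]; rewrite ?group1 ?mulg1 ?gact1.
have Eid : id \in module_End to by apply: extP.
have Ef := extP f fM fMor fJ.
have /subset_leq_card : [set one; id; ext f] \subset module_End to.
  by rewrite !subUset !sub1set E1 Eid Ef.
apply: leq_trans; rewrite -setUA cardsU1 cards2 !inE negb_or.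
have ne (h k : rT -> rT) : ~ {in M, forall m, h m = k m} -> ext k != ext h.
  by move=> hk; apply/eqP=> /ffunP eq; case: hk => m Mm; have := eq m; rewrite !extE.
rewrite !ne // => id1.
by case/trivgPn: ntM => m Mm /eqP[]; apply: id1.
Qed.

Section ChiefFactorModule.

Variables (gT : finGroupType) (G X Y : {group gT}).
Hypothesis chiefXY : chief_factor G Y X.

Lemma chief_factor_normals : [/\ Y <| G, X <| G & Y \subset X].
Proof.
have /andP[maxY nXG] := chiefXY; have /andP[/andP[sYX _] nYG] := maxgroupp maxY.
by split=> //; apply/andP; split=> //; apply: subset_trans sYX (normal_sub nXG).
Qed.

Lemma chief_factor_acts : {acts G, on group X / Y | 'Q}.
Proof.
have [/andP[_ nYG] /andP[sXG nXG] sYX] := chief_factor_normals.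
by split; [apply: actsQ | apply/quotientS/subsetT].
Qed.

Definition chief_factor_action : groupAction G (X / Y) := <[chief_factor_acts]>%gact.

Lemma chief_factor_actionE m g : m \in X / Y -> g \in G ->
  chief_factor_action m g = m ^ coset Y g.
Proof.
move=> XYm Gg; rewrite /= actbyE // qactJ.
have [/andP[_ nYG] _ _] := chief_factor_normals.
by rewrite (subsetP nYG).
Qed.

Lemma chief_factor_action_irr : acts_irreducibly G (X / Y) chief_factor_action.
Proof.
have [/andP[_ nYG] /andP[sXG nXG] sYX] := chief_factor_normals.
have /mingroupP[/andP[ntXY _] minXY] := chief_factor_minnormal chiefXY.
apply/mingroupP; split.
  rewrite ntXY /=; apply/subsetP=> g Gg; rewrite !inE Gg /=.
  by apply/subsetP=> m Mm; rewrite inE gact_stable.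
move=> H /andP[ntH actH] sHXY; apply: minXY => //; rewrite ntH /=.
apply/subsetP=> _ /morphimP[g _ Gg ->]; rewrite inE.
apply/subsetP=> _ /imsetP[h Hh ->].
by rewrite -chief_factor_actionE ?(subsetP sHXY) // (astabs_act _ (subsetP actH g Gg)).
Qed.

Lemma large_End_chief_factor : large_End_property G -> abelian (X / Y) ->
    [splits G / Y, over X / Y] -> ~~ (G / Y \subset 'C(X / Y)) ->
  has_nontrivial_endo (G / Y) (X / Y).
Proof.
move=> largeG abXY splXY ncXY.
have /mingroupp/andP[ntXY _] := chief_factor_minnormal chiefXY.
have [nsYG nsXG sYX] := chief_factor_normals.
have : 2 < #|module_End chief_factor_action|.
  apply: largeG; last first.
    exists X, Y; split; first by split.
    exists (idm_morphism (X / Y)); split; first exact: idm_isom.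
    by move=> g m Gg Mm /=; rewrite /idm -chief_factor_actionE.
  split=> //; first exact: chief_factor_action_irr.
  apply: contra ncXY => cXY; apply/subsetP=> _ /morphimP[g _ Gg ->].
  apply/centP=> m Mm; apply/commute_sym/commgP/conjg_fixP.
  by rewrite -chief_factor_actionE // (astab_act (subsetP cXY g Gg)).
case/(card_module_End_gt2P _ ntXY)=> f [fM fMor fJ f'1 f'id].
exists f; split=> //; split=> // _ m /morphimP[g _ Gg ->] Mm.
by rewrite -!chief_factor_actionE ?fJ ?fM.
Qed.

End ChiefFactorModule.

(** If [N] were central then [G] would be the direct product of [N] and a
    complement [K], so that [G^`(1) = K^`(1)] would meet [N] trivially. *)
Lemma complemented_der1_not_central (gT : finGroupType) (G N : {group gT}) :
  abelian N -> N :!=: 1 -> N \subset G^`(1) -> [splits G, over N] ->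
  ~~ (G \subset 'C(N)).
Proof.
move=> abN ntN sNG' /splitsP[K /complP[tiNK defG]]; apply/negP=> cGN.
have sKG : K \subset G by rewrite -defG mulG_subr.
have /(der_dprod 1) : N \x K = G by rewrite dprodE // (subset_trans sKG).
rewrite (derG1P abN) dprod1g => eK'; case/negP: ntN; rewrite -subG1 -tiNK subsetI subxx.
by rewrite (subset_trans sNG') // -eK' der_sub.
Qed.

Lemma chief_factor_exists (gT : finGroupType) (G L Y : {group gT}) :
    Y <| G -> L <| G -> Y \proper L ->
  exists2 X : {group gT}, chief_factor G Y X & X \subset L.
Proof.
move=> /andP[sYG nYG] nsLG ltYL.
have : [exists X : {group gT}, [&& Y \proper X, X <| G & X \subset L]].
  by apply/existsP; exists L; rewrite ltYL nsLG /=.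
case/existsP/ex_mingroup=> X /mingroupP[/and3P[ltYX nsXG sXL] minX].
exists X => //; rewrite /chief_factor nsXG andbT.
apply/maxgroupP; split; first by rewrite ltYX.
move=> Z /andP[ltZX nZG] sYZ; apply/eqP/negPn/negP=> neZY.
have ltYZ : Y \proper Z by rewrite properEneq eq_sym neZY.
have sZX := proper_sub ltZX.
case/andP: (ltZX) => _ /negP[]; rewrite (minX Z) // ltYZ (subset_trans sZX sXL) andbT /=.
by apply/andP; split=> //; apply: subset_trans sZX (normal_sub nsXG).
Qed.

(** A chief factor [X / Y] below [G^`(1)] which is not complemented gives no
    obstruction at all; a complemented one is not central, so the hypothesis
    on endomorphisms applies to it. *)
Lemma large_End_common_generator (gT : finGroupType) (G : {group gT}) :
  solvable G -> large_End_property G -> common_generator G 1%G.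
Proof.
move=> solG largeG.
have nsG'G : G^`(1) <| G := der_normal 1 G.
have nsYY (Y : {group gT}) : Y <| G ->
    common_generator (G / Y) 1%G -> common_generator G Y.
  move=> nsYG cgY; apply/(common_generator_quotient nsYG nsYG (subxx _)).
  by have -> : (Y / Y = 1)%G by apply/val_inj/trivg_quotient.
suff cgY n (Y : {group gT}) :
    Y <| G -> Y \subset G^`(1) -> #|G^`(1)| - #|Y| <= n -> common_generator G Y.
  by apply: (cgY #|G^`(1)|); rewrite ?normal1 ?sub1G ?leq_subr.
elim: n Y => [|n IHn] Y nsYG sYG' leYn;
  have [eY | neY] := eqVneq (Y : {set gT}) G^`(1).
1,3: by apply/nsYY/abelian_common_generator; rewrite // eY sub_der1_abelian.
  by case/negP: neY; rewrite eqEcard sYG' -subn_eq0 -leqn0.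
have ltYG' : Y \proper G^`(1) by rewrite properEneq neY.
have [X chXY sXG'] := chief_factor_exists nsYG nsG'G ltYG'.
have [_ nsXG sYX] := chief_factor_normals chXY.
have minXY := chief_factor_minnormal chXY.
have sXYG := quotientS Y (normal_sub nsXG).
have [_ ntXY /is_abelemP[p _ /abelem_abelian abXY]] :=
  minnormal_solvable minXY sXYG (quotient_sol Y solG).
have cgXY : common_generator (G / Y) (X / Y).
  apply/(common_generator_quotient nsYG nsXG sYX); apply: IHn => //.
  have ltYX : #|Y| < #|X|.
    by apply: proper_card; have /andP[/maxgroupp/andP[]] := chXY.
  by rewrite -ltnS; apply: leq_trans leYn; apply: ltn_sub2l ltYX; apply: proper_card.
apply: nsYY => //.
apply: (common_generator_minnormal minXY abXY sXYG) => // splXY.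
apply: large_End_chief_factor => //; apply: complemented_der1_not_central => //.
have [/andP[_ nYG] _ _] := chief_factor_normals chXY.
by rewrite -(quotient_der 1) ?quotientS.
Qed.

(** * Walks in the swap graph *)

(** Only lengths below [#|T|] are searched by [gdist]; a path without repeated
    vertices is short enough, and any path can be shortened to one. *)
Lemma gdist_le_path (T : finType) (e : rel T) x p :
  path e x p -> gdist e x (last x p) <= size p.
Proof.
case/shortenP=> q xq /= /andP[xq' uq] sqp.
apply: leq_trans (uniq_leq_size uq sqp).
have ltq : size q < #|T|.
  have uxq : uniq (x :: q) by apply/andP.
  by rewrite -[(size q).+1]/(size (x :: q)) -(card_uniqP uxq) max_card.
rewrite -ltnS; apply: find_ltn; rewrite take_iota (minn_idPl ltq).
apply/hasP; exists (size q); first by rewrite mem_iota add0n ltnSn.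
by apply/existsP; exists (in_tuple q); rewrite /= xq eqxx.
Qed.

Section SwapWalks.

Variables (gT : finGroupType) (G : {group gT}) (d : nat).
Hypothesis cgG : common_generator G 1%G.

Definition tuple_update (t : d.-tuple gT) (j : 'I_d) z : d.-tuple gT :=
  [tuple if i == j then z else tnth t i | i < d].

Definition others (t : d.-tuple gT) (j : 'I_d) : {group gT} :=
  <<[set tnth t i | i : 'I_d & i != j]>>%G.

Lemma gen_tuple_split t j :
  <<[set y in (t : d.-tuple gT)]>> = others t j <*> <[tnth t j]>.
Proof.
apply/eqP; rewrite eqEsubset; apply/andP; split; last first.
  rewrite join_subG cycle_subG mem_gen ?inE ?mem_tnth // andbT genS //.
  by apply/subsetP=> _ /imsetP[i _ ->]; rewrite inE mem_tnth.
rewrite gen_subG; apply/subsetP=> y; rewrite inE => /tnthP[i ->].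
have [->|ne] := eqVneq i j; first by rewrite mem_gen // inE cycle_id orbT.
by rewrite mem_gen // inE mem_gen ?imset_f ?inE.
Qed.

Lemma others_update t j z : others (tuple_update t j z) j = others t j.
Proof.
apply: val_inj; congr <<_>>; apply: eq_in_imset => i.
by rewrite inE tnth_mktuple => /negbTE->.
Qed.

Lemma swap_step (u v : swap_vertex G d) (j : 'I_d) :
  (forall i, i != j -> tnth (val u) i = tnth (val v) i) ->
  u = v \/ swap_adj u v.
Proof.
move=> eq_uv; have [eqj | nej] := eqVneq (tnth (val u) j) (tnth (val v) j); [left | right].
  by apply/val_inj/eq_from_tnth => i; have [->|/eq_uv] := eqVneq i j.
apply/eqP; rewrite -(cards1 j); congr #|pred_of_set _|; apply/setP=> i; rewrite !inE.
by have [-> //|/eq_uv->] := eqVneq i j; rewrite eqxx.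
Qed.

(** The same element [z] is put into place [d - n] of both tuples, so that
    the induction hypothesis applies to the new ones; for [n = 1] the tuples
    differ at most in their last entry, and a single swap is enough, whereas
    the recursive step would take two. *)
Lemma swap_walk n (u v : swap_vertex G d) :
    (forall i : 'I_d, i + n < d -> tnth (val u) i = tnth (val v) i) -> n <= d ->
  exists2 p, path (@swap_adj gT G d) u p & last u p = v /\ size p <= 2 * n - 1.
Proof.
elim: n u v => [|n IHn] u v eq_uv led.
  exists [::] => //; split=> //=; apply/val_inj/eq_from_tnth=> i.
  by apply: eq_uv; rewrite addn0.
have ltj : d - n.+1 < d by rewrite ltn_subrL; case: (d) led.
pose j := Ordinal ltj.
have ltij (i : 'I_d) : i + n < d -> i != j -> i + n.+1 < d.
  move=> ltd; rewrite -val_eqE /= => ne; rewrite addnS ltn_neqAle ltd andbT.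
  by apply: contra ne => /eqP eqd; apply/eqP; rewrite -[LHS](addnK n.+1) addnS eqd.
case: n => [|n] in IHn eq_uv led ltj @j ltij *.
  case: (@swap_step u v j) => [i ne | -> | uv]; last 2 first.
  - by exists [::].
  - by exists [:: v]; rewrite /= ?uv.
  by apply: eq_uv; apply: ltij ne; rewrite addn0.
have [/eqP genu /eqP genv] := (valP u, valP v).
rewrite (gen_tuple_split _ j) in genu; rewrite (gen_tuple_split _ j) in genv.
have [z []] := cgG (etrans (joingG1 _) genu) (etrans (joingG1 _) genv).
rewrite !joingG1 => genzu genzv.
pose upd (w : swap_vertex G d) : d.-tuple gT := tuple_update (val w) j z.
have updj w : tnth (upd w) j = z by rewrite tnth_mktuple eqxx.
have updn w i : i != j -> tnth (upd w) i = tnth (val w) i.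
  by move=> /negbTE ne; rewrite tnth_mktuple ne.
have gen w : others (val w) j <*> <[z]> = G -> <<[set y in upd w]>> == G.
  by move=> genw; rewrite (gen_tuple_split _ j) others_update updj genw.
pose u' : swap_vertex G d := Sub (upd u) (gen u genzu).
pose v' : swap_vertex G d := Sub (upd v) (gen v genzv).
have [i ltd|p pathp [lastp sizep]] := IHn u' v' _ (ltnW led).
  have [->|ne] := eqVneq i j; first by rewrite /u' /v' !SubK !updj.
  by rewrite !SubK !updn //; apply: eq_uv; apply: ltij.
have uu' : u = u' \/ swap_adj u u'.
  by apply: (@swap_step _ _ j) => i ne; rewrite SubK updn.
have v'v : v' = v \/ swap_adj v' v.
  by apply: (@swap_step _ _ j) => i ne; rewrite SubK updn.
have [q pathq [lastq sizeq]] : exists2 q, path (@swap_adj gT G d) u q &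
    last u q = v' /\ size q <= (size p).+1.
  case: uu' => [-> | uu']; first by exists p.
  by exists (u' :: p); rewrite /= ?uu'.
have le_q : (size q).+1 <= 2 * n.+2 - 1.
  move: sizep; rewrite !mulnS !add2n !subn1 /= => sizep.
  by rewrite ltnS; apply: leq_trans sizeq _.
case: v'v => [<- | v'v].
  by exists q => //; split=> //; apply: ltnW.
by exists (rcons q v); rewrite ?rcons_path ?pathq ?lastq ?last_rcons ?size_rcons.
Qed.

End SwapWalks.

(** * Groups with many endomorphisms *)

(** Either [M] and [K] intersect trivially and so commute, or [M] lies in [K] and
    meets the center of the nilpotent group [K] nontrivially, hence lies in
    it. *)
Lemma nilpotent_normal_cent_minnormal (gT : finGroupType) (G K M : {group gT}) :
  nilpotent K -> K <| G -> M \subset G -> minnormal M G -> K \subset 'C(M).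
Proof.
move=> nilK /andP[sKG nKG] sMG /mingroupP[/andP[ntM nMG] minM].
have nI : G \subset 'N(M :&: K) by apply: normsI.
have [tiMK | ntMK] := eqVneq (M :&: K) 1.
  rewrite centsC; apply/commG1P/trivgP; rewrite -tiMK commg_subI // subsetI subxx.
    by rewrite (subset_trans sMG).
  by rewrite (subset_trans sKG).
have sMK : M \subset K.
  by rewrite -(minM (M :&: K)%G) ?subsetIr ?subsetIl //= ntMK.
have nsMK : M <| K by rewrite /normal sMK (subset_trans sKG).
have ntZ := meet_center_nil nilK nsMK ntM.
suff : M \subset 'Z(K) by rewrite subsetI centsC => /andP[].
rewrite -(minM (M :&: 'Z(K))%G) ?subsetIr ?subsetIl //= ntZ normsI //.
exact: gFnorm_trans.
Qed.

Section FactorModule.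

Variables (gT : finGroupType) (G : {group gT}) (rT : finGroupType) (M : {group rT}).
Variables (to : groupAction G M) (X Y : {group gT}) (f : {morphism M >-> coset_of Y}).
Hypotheses (isof : isom M (X / Y) f)
  (fJ : {in G & M, forall g m, f (to m g) = f m ^ coset Y g}).

Lemma isom_factor_cent g m : g \in G -> m \in M ->
  coset Y g \in 'C(X / Y) -> to m g = m.
Proof.
move=> Gg Mm cg; have [injf fM] := isomP isof.
apply: (injmP injf); rewrite ?gact_stable // fJ //.
by apply/conjg_fixP/commgP/commute_sym; apply: (centP cg); rewrite -fM mem_morphim.
Qed.

(** Since the derived subgroup acts trivially, the action of any element [g] of
    [G] is an endomorphism; an element with nontrivial action gives one other
    than 0 and 1. *)
Lemma module_End_der1_cent : M :!=: 1 -> chief_factor G Y X ->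
  (G / Y)^`(1) \subset 'C(X / Y) -> ~~ (G \subset 'C(M | to)) ->
  2 < #|module_End to|.
Proof.
move=> ntM chXY cG' /subsetPn[g Gg cg].
have [/andP[_ nYG] _ _] := chief_factor_normals chXY.
have [injf fM] := isomP isof.
have stM h m : h \in G -> m \in M -> to m h \in M by move=> Gh Mm; rewrite gact_stable.
apply/(card_module_End_gt2P to ntM); exists (to^~ g); split.
- by move=> m Mm; apply: stM.
- by move=> m n Mm Mn; rewrite gactM.
- move=> h m Gh Mm; apply: (injmP injf); rewrite ?stM // !fJ ?stM // -!conjgM.
  rewrite [coset Y h * _]commgC [LHS]conjgM; apply/conjg_fixP/commgP/commute_sym.
  apply: (centP (subsetP cG' _ _)); last first.
    by rewrite conjgM -!fJ ?stM // -fM mem_morphim ?stM.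
  by rewrite derg1 mem_commg ?mem_quotient.
- move=> to1; case/trivgPn: ntM => m Mm /eqP[].
  by apply: (act_inj to g); rewrite to1 // gact1.
- move=> fix_g; case/negP: cg; rewrite !inE Gg /=.
  by apply/subsetP=> m Mm; rewrite inE fix_g.
Qed.

(** Squaring is an endomorphism other than 0 and 1. *)
Lemma module_End_odd : abelian M -> M :!=: 1 -> odd #|M| -> 2 < #|module_End to|.
Proof.
move=> abM ntM oddM; apply/(card_module_End_gt2P to ntM); exists (fun m => m ^+ 2).
have sq1 m : m \in M -> m ^+ 2 = 1 -> m = 1.
  move=> Mm m2; apply/eqP; rewrite -order_eq1 -dvdn1.
  have /eqP <- : coprime #|M| 2 by rewrite coprimen2.
  by rewrite dvdn_gcd order_dvdG // order_dvdn m2 eqxx.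
split.
- by move=> m; apply: groupX.
- by move=> m n Mm Mn; rewrite expgMn //; apply: (centsP abM).
- by move=> g m Gg Mm; rewrite gactX.
- by move=> all1; case/trivgPn: ntM => m Mm /eqP[]; apply/sq1/all1.
- move=> fixM; case/trivgPn: ntM => m Mm /eqP[].
  by apply: (mulgI m); rewrite mulg1; apply: fixM.
Qed.

End FactorModule.

Lemma der1_nilpotent_or_odd_large_End (gT : finGroupType) (G : {group gT}) :
  solvable G -> nilpotent G^`(1) \/ odd #|G^`(1)| -> large_End_property G.
Proof.
move=> solG nil_odd rT M to [abM irrM ntrivM] [X [Y [[chXY splXY] [f [isof fJ]]]]].
have /mingroupp/andP[ntM _] := irrM.
have minXY := chief_factor_minnormal chXY.
have [nsYG nsXG sYX] := chief_factor_normals chXY.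
have nYG := normal_norm nsYG.
have sXYG := quotientS Y (normal_sub nsXG).
have nsG'G : (G / Y)^`(1) <| G / Y := der_normal 1 _.
have eG' : (G / Y)^`(1) = G^`(1) / Y by rewrite quotient_der.
case: nil_odd => [nilG' | oddG'].
  apply: (module_End_der1_cent isof fJ) => //.
  apply: nilpotent_normal_cent_minnormal nsG'G sXYG minXY.
  by rewrite /= eG' quotient_nil.
have [oddM | evenM] := boolP (odd #|M|); first exact: module_End_odd.
have [_ _ /is_abelemP[p _ /abelem_pgroup pXY]] :=
  minnormal_solvable minXY sXYG (quotient_sol Y solG).
have p2 : 2 = p.
  have : 2 %| #|X / Y| by rewrite -(isom_card isof) dvdn2.
  by move/(pgroupP pXY) => /(_ isT); rewrite inE => /eqP.
have oddQ : odd #|(G / Y)^`(1)|.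
  by rewrite eG' (dvdn_odd (dvdn_quotient _ _)).
have cXY : G / Y \subset 'C(X / Y).
  rewrite centsC; apply/commG1P/trivgP.
  rewrite -(@coprime_TIg _ (X / Y)%G ((G / Y)^`(1))%G) /=.
    by rewrite subsetI commg_subl quotient_norms ?normal_norm //= derg1 commSg.
  by apply: (pnat_coprime pXY); rewrite -p2 -odd_2'nat.
case/negP: ntrivM; apply/subsetP=> g Gg; rewrite !inE Gg /=.
apply/subsetP=> m Mm; rewrite inE; apply/eqP.
by apply: (isom_factor_cent isof fJ) => //; rewrite (subsetP cXY) ?mem_quotient.
Qed.

Theorem theorem3p13 (gT : finGroupType) (G : {group gT}) :
  solvable G ->
  (large_End_property G ->
     forall d : nat, 'm(G) <= d ->
       graph_connected (@swap_adj gT G d) /\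
       diameter (@swap_adj gT G d) <= 2 * d - 1) /\
  (nilpotent G^`(1) \/ odd #|G^`(1)| -> large_End_property G).
Proof.
move=> solG; split; last exact: der1_nilpotent_or_odd_large_End.
move=> largeG d _; have cgG := large_End_common_generator solG largeG.
have walk (u v : swap_vertex G d) : exists2 p, path (@swap_adj gT G d) u p &
    last u p = v /\ size p <= 2 * d - 1.
  by apply: swap_walk => // i; rewrite ltnNge leq_addl.
split=> [u v | ].
  by have [p pathp [<- _]] := walk u v; apply/connectP; exists p.
apply/bigmax_leqP=> u _; apply/bigmax_leqP=> v _.
have [p pathp [<- sizep]] := walk u v.
exact: leq_trans (gdist_le_path pathp) sizep.
Qed.
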